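(* Let $1<c<n$ be integers and $\gamma\le -1$. For every connected graph $G$ of order $n$ with chromatic number $c$, \[{}^0R_{\gamma}(G)\le n-c+(n-1)^{\gamma}+(c-1)(c-1)^{\gamma},\] with equality if and only if $G=PA_n(c)$.
   Context: ${}^0R_{\gamma}(G)=\sum_{u\in V(G)} d(u)^{\gamma}$. The pineapple graph $PA_n(c)$ is obtained from the complete graph $K_c$ by attaching $n-c$ pendant vertices to one vertex of $K_c$. Graphs are finite and simple. *)

(* Defs.v *)
From mathcomp Require Import all_boot all_order all_algebra.
From mathcomp Require Import reals exp.
Set Implicit Arguments.
Unset Strict Implicit.
Unset Printing Implicit Defensive.
Import Order.TTheory GRing.Theory Num.Theory.

Record sgraph := SGraph {
  vertex :> finType;
  adj : rel vertex;
  adj_sym : symmetric adj;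
  adj_irrefl : irreflexive adj }.

Arguments adj {s}.

Definition deg (G : sgraph) (u : G) : nat := #|[set v | adj u v]|.

Definition connected (G : sgraph) : Prop :=
  (0 < #|G|) /\ forall u v : G, connect adj u v.

Definition colorable (G : sgraph) (k : nat) : bool :=
  [exists f : {ffun G -> 'I_k}, forall u, forall v, adj u v ==> (f u != f v)].

Lemma colorable_ex (G : sgraph) : exists k, colorable G k.
Proof.
exists #|G|; apply/existsP; exists [ffun u => enum_rank u].
apply/forallP => u; apply/forallP => v; apply/implyP => uv; rewrite !ffunE.
by apply: contraTneq uv => /enum_rank_inj ->; rewrite adj_irrefl.
Qed.

Definition chromatic_number (G : sgraph) : nat := ex_minn (colorable_ex G).

Definition graph_iso (G H : sgraph) : Prop :=
  exists f : G -> H, bijective f /\ forall u v, adj (f u) (f v) = adj u v.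

Section Pineapple.
Variables n c : nat.

(* The clique K_c is on the vertices 0, ..., c - 1, and the vertices
   c, ..., n - 1 are pendant at 0 (meaningful for 0 < c <= n). *)
Definition pineapple_adj (u v : 'I_n) : bool :=
  (u != v) && [|| (u < c) && (v < c),
                  (u == 0 :> nat) && (c <= v)
                | (v == 0 :> nat) && (c <= u)].

Lemma pineapple_sym : symmetric pineapple_adj.
Proof.
move=> u v; rewrite /pineapple_adj eq_sym (andbC (u < c)).
by rewrite (orbC ((u == 0 :> nat) && _)).
Qed.

Lemma pineapple_irrefl : irreflexive pineapple_adj.
Proof. by move=> u; rewrite /pineapple_adj eqxx. Qed.

Definition pineapple : sgraph := SGraph pineapple_sym pineapple_irrefl.

End Pineapple.

Local Open Scope ring_scope.

(* A vertex of degree 0 contributes powR 0 gamma, which is 0 for gamma != 0;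
   connected graphs on at least two vertices have no such vertex. *)
Definition general_randic0 (R : realType) (gamma : R) (G : sgraph) : R :=
  \sum_(u : G) (deg u)%:R `^ gamma.

(* Main.v *)
Require Import Defs.
From mathcomp Require Import all_boot all_order all_algebra.
From mathcomp Require Import reals exp.
From mathcomp Require Import interval_inference convex hoelder.
From mathcomp Require Import ring lra zify.
Import Order.TTheory GRing.Theory Num.Theory.
Local Open Scope ring_scope.

(** Write f(k) = k^gamma, and let B be the set of vertices of degree at least
    c - 1. Colouring B first and the remaining vertices greedily with c - 1
    colours shows that B has at least c vertices, and that it is a clique if
    it has exactly c. If c > 2 and B is larger, then f(c - 1) <= 1/2 makes the
    inequality strict. Otherwise G contains a clique S of size c (an edge when
    c = 2). If some vertex outside S has degree at least 2, it loses at least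
    1/2, while the clique vertex with an outside neighbour contributes at most
    f(c) <= 1/2, so the inequality is again strict. Otherwise all outside
    vertices are pendant at S. If they hang at one vertex, G is the pineapple;
    if not, bound f on the degrees of S by its chord on [c - 1, n - 1], which
    sums to exactly the required value, strictly at a vertex of S whose degree
    lies inside that interval. *)

Set Implicit Arguments.
Unset Strict Implicit.

(** * Powers with exponent at most -1: monotonicity, bounds and chords *)

Section NegativePower.
Variables (R : realType) (r : R).

(** Trades a negative exponent for a positive one, where monotonicity and convexity of powers
    apply. *)
Lemma powR_inv_opp (x : R) : 0 < x -> x `^ r = x^-1 `^ (- r).
Proof. by move=> x0; rewrite -powR_inv1 ?ltW// -powRrM mulN1r opprK. Qed.

Lemma le0_ler_powR (x y : R) : r <= 0 -> 0 < x -> x <= y -> y `^ r <= x `^ r.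
Proof.
move=> r0 x0 xy; have y0 := lt_le_trans x0 xy.
rewrite !powR_inv_opp//; apply: ge0_ler_powR.
- by rewrite oppr_ge0.
- by rewrite nnegrE invr_ge0 ltW.
- by rewrite nnegrE invr_ge0 ltW.
- by rewrite lef_pV2.
Qed.

Hypothesis r_le : r <= -1.

Lemma powR_le_inv (k : nat) : (0 < k)%N -> k%:R `^ r <= (k%:R^-1 : R).
Proof. by move=> k0; rewrite -powR_inv1// ler_powR// ler1n. Qed.

Lemma powR_le_half (k : nat) : (1 < k)%N -> k%:R `^ r <= (2^-1 : R).
Proof.
move=> k1; apply: le_trans (powR_le_inv (ltnW k1)) _.
by rewrite lef_pV2 ?posrE ?ltr0n ?ler_nat// ltnW.
Qed.

Lemma powR_le1 (k : nat) : (0 < k)%N -> k%:R `^ r <= (1 : R).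
Proof.
by move=> k0; apply: le_trans (powR_le_inv k0) _; rewrite invf_le1 ?ler1n ?ltr0n.
Qed.

(* With p = -r >= 1, x^r = (1/x)^p: the strictness comes from x |-> 1/x and
   the remaining inequality from the convexity of t |-> t^p. *)
Lemma powR_chord_lt (a b x : R) : 0 < a -> a < x -> x < b ->
  x `^ r < ((b - x) * a `^ r + (x - a) * b `^ r) / (b - a).
Proof.
move=> a0 ax xb.
have x0 : 0 < x by lra.
have b0 : 0 < b by lra.
have ba : 0 < b - a by lra.
(* The weight t = (b - x) / (b - a) gives x = t a + (1 - t) b; convexity is applied with the same
   weight to 1/a and 1/b. *)
have t0 : 0 <= (b - x) / (b - a) by rewrite divr_ge0//; lra.
have t1 : (b - x) / (b - a) <= 1 by rewrite ler_pdivrMr// mul1r; lra.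
have p1 : 1 <= - r by rewrite lerNr.
have := convex_powR p1 (Itv01 t0 t1) (x := a^-1) (y := b^-1).
rewrite !classical_sets.inE/= !in_itv/= !andbT !invr_ge0 (ltW a0) (ltW b0) => /(_ isT isT).
rewrite convRE [X in X `^ _ <= _]convRE /= /unstable.onem => conv.
rewrite !powR_inv_opp//.
have -> : ((b - x) * a^-1 `^ (- r) + (x - a) * b^-1 `^ (- r)) / (b - a)
   = (b - x) / (b - a) * a^-1 `^ (- r)
     + (1 - (b - x) / (b - a)) * b^-1 `^ (- r).
  by field; lra.
apply: lt_le_trans conv.
(* This weighted mean of the inverses exceeds 1/x, because (a + b - x) x - a b = (x - a)(b - x) >
   0. *)
have -> : (b - x) / (b - a) / a + (1 - (b - x) / (b - a)) / b
   = (a + b - x) / (a * b) by field; rewrite !gt_eqF.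
apply: gt0_ltr_powR.
- exact: lt_le_trans ltr01 p1.
- by rewrite nnegrE invr_ge0 ltW.
- by rewrite nnegrE divr_ge0//; [lra | apply: mulr_ge0; lra].
rewrite ltr_pdivlMr ?mulr_gt0// mulrC ltr_pdivrMr//.
by rewrite -subr_gt0; have -> : (a + b - x) * x - a * b = (x - a) * (b - x);
  [ring | rewrite mulr_gt0//; lra].
Qed.

Lemma powR_chord_le (a b x : R) : 0 < a -> a < b -> a <= x -> x <= b ->
  x `^ r <= ((b - x) * a `^ r + (x - a) * b `^ r) / (b - a).
Proof.
move=> a0 ab; rewrite (le_eqVlt a x) (le_eqVlt x b) => /predU1P[<-|ax].
  by move=> _; rewrite subrr mul0r addr0 mulrC mulKf // subr_eq0 gt_eqF.
move=> /predU1P[->|xb].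
  by rewrite subrr mul0r add0r mulrC mulKf // subr_eq0 gt_eqF.
by rewrite ltW ?powR_chord_lt.
Qed.

End NegativePower.

Local Open Scope nat_scope.

(** * Greedy colouring and vertices of large degree *)

Section Colouring.
Variable G : sgraph.
Implicit Types (A S : {set G}) (k : nat).

Lemma colorable_chromatic k : colorable G k -> chromatic_number G <= k.
Proof. by rewrite /chromatic_number; case: ex_minnP => m _ /[apply]. Qed.

Definition proper_on A k (g : G -> 'I_k) :=
  forall u v, u \in A -> v \in A -> adj u v -> g u != g v.

Lemma proper_on_setT k (g : G -> 'I_k) : proper_on [set: G] g -> colorable G k.
Proof.
move=> gP; apply/existsP; exists [ffun u => g u].
apply/forallP => u; apply/forallP => v; apply/implyP => uv.
by rewrite !ffunE gP ?inE.
Qed.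

(** Induction on the number of vertices outside [A]: such a vertex has fewer than [k] neighbours, so
    some colour is free for it. Only the values of [g] on [A] matter, but the new colour avoids
    those of all neighbours. *)
Lemma greedy_colorable A k (g : G -> 'I_k) :
  proper_on A g -> (forall v, v \notin A -> deg v < k) -> colorable G k.
Proof.
have [m] := ubnP #|~: A|; elim: m => // m IHm in A g *.
rewrite ltnS => Am gP degA.
have [A0|[v]] := set_0Vmem (~: A).
  apply: (@proper_on_setT _ g).
  by have -> : [set: G] = A; [rewrite -[A]setCK A0 setC0 | ].
rewrite inE => vA.
have [col colP] : exists col, col \notin g @: [set u | adj v u].
  apply/existsP; rewrite -negb_forall; apply/negP => /forallP all_col.
  have := degA _ vA; rewrite ltnNge => /negP; apply.
  rewrite -[k in k <= _]card_ord; apply: leq_trans (leq_imset_card g _).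
  by apply/subset_leq_card/subsetP => x _; exact: all_col.
pose g' u := if u == v then col else g u.
apply: (IHm (v |: A) g').
- apply: leq_trans Am; rewrite setCU setIC -setDE.
  by rewrite (cardsD1 v (~: A)) inE vA.
- have g'v x : adj v x -> g' x != col.
    move=> vx; rewrite /g'; have [xv|_] := eqVneq x v; first by rewrite xv adj_irrefl in vx.
    by apply: contra colP => /eqP <-; apply: imset_f; rewrite inE.
  move=> x y; rewrite !inE => xA yA xy.
  have [xv|xv] := eqVneq x v.
    by rewrite eq_sym {2}/g' xv eqxx g'v// -xv.
  have [yv|yv] := eqVneq y v.
    by rewrite {2}/g' yv eqxx g'v// -yv adj_sym.
  rewrite /g' (negPf xv) (negPf yv) gP//.
    by move: xA; rewrite (negPf xv).
  by move: yA; rewrite (negPf yv).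
- by move=> u; rewrite inE negb_or => /andP[_ /degA].
Qed.

Lemma injective_colouring A k : 0 < k -> #|A| <= k ->
  exists g : G -> 'I_k, {in A &, injective g}.
Proof.
case: k => // k _ Ak; exists (fun v => inord (index v (enum A))) => u v uA vA.
have idx x : x \in A -> index x (enum A) < k.+1.
  by move=> xA; apply: leq_trans Ak; rewrite cardE index_mem mem_enum.
move=> /(congr1 val); rewrite /= !inordK ?idx//.
by apply: (index_inj u); rewrite mem_enum.
Qed.

Variables (k : nat).
Hypotheses (k_gt0 : 0 < k) (chi_gt : k < chromatic_number G).
Let big := [set v : G | k <= deg v].

Lemma not_greedy_colorable (g : G -> 'I_k) : ~ proper_on big g.
Proof.
move=> gP; have := chi_gt; rewrite ltnNge => /negP; apply.
apply/colorable_chromatic/(greedy_colorable gP) => v.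
by rewrite inE -ltnNge.
Qed.

(** At most [k] vertices could receive distinct colours, and the greedy extension would then colour
    [G] with [k] colours. *)
Lemma card_large_degree : k < #|big|.
Proof.
rewrite ltnNge; apply/negP => /(injective_colouring k_gt0)[g gI].
apply: (@not_greedy_colorable g) => u v uB vB uv.
by apply: contraTneq uv => /gI ->; rewrite ?adj_irrefl.
Qed.

(* Two non-adjacent vertices of large degree could share a colour. *)
Lemma large_degree_clique : #|big| = k.+1 ->
  {in big &, forall u v, u != v -> adj u v}.
Proof.
move=> bk u v uB vB uv; apply/negPn/negP => nadj.
have [g gI] : exists g : G -> 'I_k, {in big :\ v &, injective g}.
  by apply: injective_colouring => //; move: bk; rewrite (cardsD1 v) vB add1n => -[->].
apply: (@not_greedy_colorable (fun x => g (if x == v then u else x))).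
have dB x : x \in big -> (if x == v then u else x) \in big :\ v.
  by case: eqP => [_ _|/eqP xv xB]; rewrite in_setD1 ?uv// xv.
move=> x y xB yB; apply: contraTneq => /(gI _ _ (dB _ xB) (dB _ yB)).
have [->|xv] := eqVneq x v; have [->|yv] := eqVneq y v; rewrite ?adj_irrefl//.
- by move=> <-; rewrite adj_sym.
- by move=> ->.
- by move=> ->; rewrite adj_irrefl.
Qed.

End Colouring.

(** * Edges leaving a set and pendant vertices in connected graphs *)

Section Connected.
Variable G : sgraph.
Hypothesis G_conn : connected G.

(** If no edge left [A], then [A] would be closed under adjacency, hence a union of components. *)
Lemma connected_cut (A : {set G}) x y : x \in A -> y \notin A ->
  exists u v, [/\ u \in A, v \notin A & adj u v].
Proof.
move=> xA yA; case: G_conn => _ /(_ x y) xy.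
have [/existsP[u /existsP[v /and3P[uA vA uv]]]|noex] :=
  boolP [exists u, exists v, [&& u \in A, v \notin A & adj u v]].
  by exists u, v.
have closedA : closed adj (mem A).
  apply: intro_closed => [|u v uv uA]; first exact/sym_connect_sym/adj_sym.
  apply: contraR noex => vA; apply/existsP; exists u; apply/existsP; exists v.
  by rewrite uA vA.
by move: yA; rewrite -[_ \in A](closed_connect closedA xy) xA.
Qed.

Lemma connected_neighbour : 1 < #|G| -> forall u : G, exists v, adj u v.
Proof.
move=> G1 u.
have /card_gt0P[y] : 0 < #|~: [set u]| by rewrite cardsC1; lia.
rewrite inE => yu.
have [a [v [/set1P-> _ uv]]] := connected_cut (set11 u) yu.
by exists v.
Qed.

Lemma deg_gt0 : 1 < #|G| -> forall u : G, 0 < deg u.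
Proof.
move=> G1 u; have [v uv] := connected_neighbour G1 u.
by apply/card_gt0P; exists v; rewrite inE.
Qed.

Lemma deg1P (v : G) : deg v = 1 -> exists w, adj v =1 pred1 w.
Proof.
move/eqP/cards1P => [w vw]; exists w => x.
by have /setP/(_ x) := vw; rewrite !inE.
Qed.

(* Otherwise the pendant edge would be a whole component. *)
Lemma pendant_neighbour (A : {set G}) v : A != set0 ->
  (forall u, u \notin A -> deg u = 1) -> v \notin A ->
  exists2 w, w \in A & adj v =1 pred1 w.
Proof.
move=> /set0Pn[x xA] deg1 vA; have [w vw] := deg1P (deg1 _ vA).
exists w => //; apply: contraT => wA.
have [z wz] := deg1P (deg1 _ wA).
have zv : z = v by apply/eqP; rewrite eq_sym -[_ == _]/(pred1 z v) -wz adj_sym vw /= eqxx.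
have xnot : x \notin [set v; w].
  by rewrite !inE; apply/norP; split; apply: contraTneq xA => ->.
have [a [b [aP bP ab]]] := connected_cut (set21 v w) xnot.
move: bP; rewrite !inE => /norP[bv bw].
move: aP ab; rewrite !inE => /orP[] /eqP ->.
  by rewrite vw /= (negPf bw).
by rewrite wz /= zv (negPf bv).
Qed.

End Connected.

(** * Degrees around a clique and recognition of the pineapple *)

Lemma deg_lt_order (G : sgraph) (u : G) : deg u < #|G|.
Proof.
rewrite -cardsT; apply: proper_card; apply/properP; split; first exact: subsetT.
by exists u; rewrite ?inE ?adj_irrefl.
Qed.

Section Clique.
Variables (G : sgraph) (S : {set G}).
Hypothesis S_clique : {in S &, forall u v, u != v -> adj u v}.

(** The outside neighbours are counted by a sum of booleans so that the order of summation can be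
    exchanged when degrees are added up. *)
Lemma deg_clique u : u \in S ->
  deg u = #|S|.-1 + \sum_(v in ~: S) adj u v.
Proof.
move=> uS; rewrite /deg -(cardsID S) (cardsD1 u S) uS /=.
congr (_ + _).
  apply: eq_card => v; rewrite !inE; have [->|uv] := eqVneq v u.
    by rewrite adj_irrefl.
  have [vS|] := boolP (v \in S); rewrite ?andbF// andbT.
  by rewrite S_clique// eq_sym.
rewrite -sum1_card big_mkcond [RHS]big_mkcond; apply: eq_bigr => v _.
by rewrite !inE; case: (v \in S) => //=; case: adj.
Qed.

Lemma deg_clique_ge u : u \in S -> #|S|.-1 <= deg u.
Proof. by move/deg_clique ->; rewrite leq_addr. Qed.

Lemma deg_clique_gt u v : u \in S -> v \notin S -> adj u v -> #|S|.-1 < deg u.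
Proof.
move=> uS vS uv; rewrite deg_clique// (bigD1 v) ?inE//= uv.
by rewrite addnA addn1 ltnS leq_addr.
Qed.

(** Double counting: each outside vertex is met exactly once, from its only neighbour. *)
Lemma sum_deg_clique :
  (forall v, v \notin S -> exists2 w, w \in S & adj v =1 pred1 w) ->
  \sum_(u in S) deg u = #|S| * #|S|.-1 + #|~: S|.
Proof.
move=> pend; rewrite (eq_bigr _ deg_clique) big_split /= sum_nat_const.
congr (_ + _); rewrite exchange_big /= -sum1_card; apply: eq_bigr => v.
rewrite inE => /pend[w wS vw].
rewrite (bigD1 w)//= adj_sym vw /= eqxx big1 ?addn0// => u /andP[_ uw].
by rewrite adj_sym vw /= (negPf uw).
Qed.

Lemma pineapple_iso w : w \in S ->
  (forall v, v \notin S -> adj v =1 pred1 w) ->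
  graph_iso G (pineapple #|G| #|S|).
Proof.
move=> wS pend.
(* The position in [s] is the pineapple label: the centre first, then the rest of the clique, then
   the pendant vertices. *)
pose s := w :: enum (S :\ w) ++ enum (~: S).
have us : uniq s.
  rewrite /s /= cat_uniq !enum_uniq mem_cat !mem_enum !inE eqxx wS /= andbT.
  apply/hasPn => x; rewrite !mem_enum !inE => xS.
  by rewrite (negPf xS) andbF.
have ms x : x \in s.
  by rewrite /s inE mem_cat !mem_enum !inE; case: eqP => //=; case: (x \in S).
have sz : size s = #|G|.
  by rewrite -(card_uniqP us); apply: eq_card => x; rewrite ms.
have flt x : index x s < #|G| by rewrite -sz index_mem.
pose f x : pineapple #|G| #|S| := Ordinal (flt x).
have fI : injective f.
  by move=> x y /(congr1 val) fxy; apply: (index_inj x (s := s)) fxy; rewrite ms.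
have f0 x : (f x == 0 :> nat) = (x == w).
  by rewrite /f /s /= (eq_sym x w); case: (w == x).
have fS x : (f x < #|S|) = (x \in S).
  rewrite /f /s /= (cardsD1 w S) wS add1n (eq_sym w x).
  have [->|xw] := eqVneq x w; first by rewrite wS.
  rewrite ltnS index_cat mem_enum !inE xw /=; case: ifP => xS.
    by rewrite cardE index_mem mem_enum !inE xw xS.
  by rewrite -cardE ltnNge leq_addr.
exists f; split.
  by apply: inj_card_bij => //; rewrite card_ord.
move=> u v; rewrite -[LHS]/(pineapple_adj #|S| (f u) (f v)) /pineapple_adj.
rewrite !f0 !(leqNgt #|S|) !fS.
rewrite (inj_eq fI).
have [->|uv] /= := eqVneq u v; first by rewrite adj_irrefl.
have [uS|uS] := boolP (u \in S); have [vS|vS] := boolP (v \in S);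
  rewrite /= ?andbT ?andbF ?orbF.
- by rewrite S_clique.
- by rewrite adj_sym pend.
- by rewrite pend.
- by rewrite pend//= (negPf (_ : u != w))//; apply: contraNneq uS => ->.
Qed.

End Clique.


(** * Degrees under isomorphism and in the pineapple *)

Lemma deg_iso (G H : sgraph) (f : G -> H) : bijective f ->
  (forall u v, adj (f u) (f v) = adj u v) -> forall u, deg (f u) = deg u.
Proof.
move=> fB fadj u; rewrite /deg -(card_imset _ (bij_inj fB)).
have [g gK fK] := fB; apply: eq_card => y; rewrite inE; apply/idP/imsetP.
  by move=> uy; exists (g y); rewrite ?inE ?fK// -fadj fK.
by move=> [x]; rewrite inE => ux ->; rewrite fadj.
Qed.

Lemma deg_pineapple n c (i : pineapple n c) : 1 < c -> c < n ->
  deg i = if i == 0 :> nat then n.-1 else if i < c then c.-1 else 1.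
Proof.
move=> c1 cn; rewrite /deg.
have [i0|i0] := eqVneq (i : nat) 0.
  have -> : [set v | adj i v] = ~: [set i].
    apply/setP => v; rewrite !inE /adj /= /pineapple_adj i0 eqxx eq_sym.
    by rewrite (ltnW c1) /=; case: leqP; rewrite ?andbT.
  by rewrite cardsC1 card_ord.
case: ifP => ic.
  have -> : [set v | adj i v] = [set v : 'I_n | v < c] :\ i.
    apply/setP => v; rewrite !inE /adj /= /pineapple_adj (negPf i0) ic eq_sym.
    by rewrite (leqNgt c i) ic /= andbF orbF.
  have cardc : #|[set v : 'I_n | v < c]| = c.
    rewrite -sum1dep_card -(big_ord_widen n (fun=> 1)) ?(ltnW cn)//.
    by rewrite sum1_card card_ord.
  by have := cardsD1 (i : 'I_n) [set v : 'I_n | v < c]; rewrite cardc inE ic => /(congr1 predn) ->.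
have n0 : 0 < n by lia.
have -> : [set v | adj i v] = [set Ordinal n0].
  apply/setP => v; rewrite !inE /adj /= /pineapple_adj (negPf i0) ic /=.
  rewrite (leqNgt c i) ic andbT -val_eqE /= -val_eqE /=.
  by have [->|] := eqVneq (v : nat) 0; rewrite ?andbT ?andbF.
exact: cards1.
Qed.

Local Open Scope ring_scope.

(** * The extremal value and the three strict inequalities *)

Section Randic.
Variables (R : realType) (gamma : R).
Hypothesis gamma_le : gamma <= -1.
Local Notation f k := ((k)%:R `^ gamma : R).

(** Subtraction is that of [nat]; for 1 < c < n it agrees with subtraction in the reals. *)
Definition pineapple_bound (n c : nat) : R :=
  (n - c)%:R + f n.-1 + c.-1%:R * f c.-1.

Lemma general_randic0_iso (G H : sgraph) : graph_iso G H ->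
  general_randic0 gamma G = general_randic0 gamma H.
Proof.
move=> [h [hB hadj]]; rewrite /general_randic0 [RHS](reindex h) /=.
  by apply: eq_bigr => u _; rewrite (deg_iso hB hadj).
exact: onW_bij.
Qed.

Lemma general_randic0_pineapple n c : (1 < c)%N -> (c < n)%N ->
  general_randic0 gamma (pineapple n c) = pineapple_bound n c.
Proof.
move=> c1 cn; rewrite /general_randic0 /=.
pose g (i : nat) : R :=
  f (if i == 0%N then n.-1 else if (i < c)%N then c.-1 else 1%N).
rewrite (eq_bigr (fun i : 'I_n => g i)); last first.
  by move=> i _; rewrite deg_pineapple.
(* The range splits into the centre 0, the other clique vertices 1, ..., c - 1, and the pendant
   vertices from c on. *)
rewrite -(big_mkord xpredT g) big_ltn; last by lia.
rewrite (big_cat_nat (n := c)) /=; [|lia..].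
rewrite (eq_big_nat _ _ (F2 := fun=> f c.-1)); last first.
  move=> i /andP[i0 ic]; rewrite /g ic; case: eqP => // i0'.
  by rewrite i0' in i0.
rewrite (@eq_big_nat _ _ _ c n _ (fun=> 1)); last first.
  move=> i /andP[ci _]; rewrite /g ltnNge ci /=; case: eqP => i0; first lia.
  by rewrite powR1.
rewrite !sumr_const_nat /pineapple_bound /g /= subn1.
by rewrite -[_ *+ c.-1]mulr_natl; ring.
Qed.

Lemma powR_nat_anti (j k : nat) : (0 < j)%N -> (j <= k)%N -> f k <= f j.
Proof.
move=> j0 jk; apply: le0_ler_powR; rewrite ?ltr0n ?ler_nat//.
by apply: le_trans gamma_le _; rewrite lerN10.
Qed.

Lemma powR_nat_gt0 (k : nat) : (0 < k)%N -> 0 < f k.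
Proof. by move=> k0; rewrite powR_gt0// ltr0n. Qed.

Variable G : sgraph.
Hypothesis deg_pos : forall u : G, (0 < deg u)%N.

Lemma general_randic0_split (S : {set G}) :
  general_randic0 gamma G
  = \sum_(u in S) f (deg u) + \sum_(u in ~: S) f (deg u).
Proof.
rewrite /general_randic0 (bigID (mem S)) /=; congr (_ + _).
by apply: eq_bigl => u; rewrite inE.
Qed.

Lemma sum_setC_le (S : {set G}) :
  \sum_(u in ~: S) f (deg u) <= #|~: S|%:R.
Proof.
by rewrite -sumr_const; apply: ler_sum => u _; exact: powR_le1.
Qed.

Lemma randic_lt_many (S : {set G}) (c : nat) : (2 < c)%N -> (c < #|S|)%N ->
  (forall u, u \in S -> (c.-1 <= deg u)%N) ->
  general_randic0 gamma G < pineapple_bound #|G| c.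
Proof.
move=> c2 cS degS; rewrite (general_randic0_split S) /pineapple_bound.
have hC := sum_setC_le S.
have hS : \sum_(u in S) f (deg u) <= #|S|%:R * f c.-1.
  rewrite mulr_natl -sumr_const; apply: ler_sum => u /degS cu.
  by apply: powR_nat_anti => //; lia.
have cardG := cardsC S.
have p0 : 0 < f #|G|.-1 by apply: powR_nat_gt0; lia.
have q12 : f c.-1 <= 2^-1 by apply: powR_le_half => //; lia.
have -> : (#|G| - c)%N = (#|~: S| + (#|S| - c))%N by lia.
rewrite natrD natrB ?(ltnW cS)//.
have c1E : c.-1%:R = c%:R - 1 :> R by rewrite -subn1 natrB //; lia.
have sc : c%:R + 1 <= #|S|%:R :> R by rewrite natr1 ler_nat.
move: hC hS p0 q12 sc; set p := f #|G|.-1; set q := f c.-1.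
rewrite c1E.
move: (\sum_(u in S) _) (\sum_(u in ~: S) _) => X Y.
move: (#|S|%:R : R) (#|~: S|%:R : R) (c%:R : R) p q => s t d p q hC hS p0 q12 sc.
(* What remains is (s - d) - (s - d + 1) q + p > 0; replacing q by 1/2 leaves (s - d - 1)/2 + p,
   which is positive as s >= d + 1. *)
have : 0 <= (2^-1 - q) * (s - d + 1) by apply: mulr_ge0; lra.
nra.
Qed.

Variable S : {set G}.
Hypothesis S_clique : {in S &, forall u v, u != v -> adj u v}.
Hypothesis S_gt1 : (1 < #|S|)%N.

(** Both [v] and [x], whose degree is at least [#|S|], contribute at most 1/2, together the 1 that
    the bound grants to [v]. The positive term at n - 1 is left over. *)
Lemma randic_lt_not_pendant x y v : x \in S -> y \notin S -> adj x y ->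
  v \notin S -> (1 < deg v)%N ->
  general_randic0 gamma G < pineapple_bound #|G| #|S|.
Proof.
move=> xS yS xy vS degv; rewrite (general_randic0_split S) /pineapple_bound.
have cardG := cardsC S.
have -> : (#|G| - #|S|)%N = (#|~: S :\ v|).+1.
  by have := cardsD1 v (~: S); rewrite inE vS add1n => cardC; lia.
have hS : \sum_(u in S) f (deg u) <= 2^-1 + #|S|.-1%:R * f #|S|.-1.
  rewrite (bigD1 x)//=; apply: lerD.
    by apply: powR_le_half => //; have := deg_clique_gt S_clique xS yS xy; lia.
  have -> : #|S|.-1 = #|S :\ x| by rewrite (cardsD1 x S) xS.
  rewrite mulr_natl -sumr_const; under eq_bigl do rewrite andbC -in_setD1.
  apply: ler_sum => u; rewrite in_setD1 => /andP[_ uS].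
  have -> : #|S :\ x| = #|S|.-1 by rewrite (cardsD1 x S) xS.
  by apply: powR_nat_anti; [lia | exact: deg_clique_ge].
have hC : \sum_(u in ~: S) f (deg u) <= 2^-1 + #|~: S :\ v|%:R.
  rewrite (bigD1 v) ?inE//=; apply: lerD; first exact: powR_le_half.
  rewrite -sumr_const; under eq_bigl do rewrite andbC -in_setD1.
  by apply: ler_sum => u _; exact: powR_le1.
have p0 : 0 < f #|G|.-1 by apply: powR_nat_gt0; lia.
rewrite -natr1; lra.
Qed.

Lemma randic_lt_two_centres w w' v v' : w \in S -> w' \in S -> w != w' ->
  v \notin S -> v' \notin S -> adj v w -> adj v' w' ->
  (forall v, v \notin S -> exists2 w, w \in S & adj v =1 pred1 w) ->
  general_randic0 gamma G < pineapple_bound #|G| #|S|.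
Proof.
move=> wS w'S ww' vS v'S vw v'w' pend.
rewrite (general_randic0_split S) /pineapple_bound.
have cardG := cardsC S.
have -> : (#|G| - #|S|)%N = #|~: S| by lia.
have C0 : (0 < #|~: S|)%N by apply/card_gt0P; exists v; rewrite inE.
rewrite addrC -addrA; apply: ler_ltD; first exact: sum_setC_le.
set a : R := #|S|.-1%:R; set b : R := #|G|.-1%:R.
have a0 : 0 < a by rewrite ltr0n; lia.
have ab : a < b by rewrite ltr_nat; lia.
(* The chord of the power function over [a, b], which dominates it at every degree in [S]. *)
pose L (x : R) := ((b - x) * a `^ gamma + (x - a) * b `^ gamma) / (b - a).
have chord u : u \in S -> f (deg u) <= L (deg u)%:R.
  move=> uS; apply: powR_chord_le => //; rewrite ler_nat.
    exact: deg_clique_ge.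
  by have := deg_lt_order u; lia.
(* The degree of [w] exceeds a because of [v], and is at most n - 2 because [w] is adjacent neither
   to itself nor to [v']. *)
have chordw : f (deg w) < L (deg w)%:R.
  apply: powR_chord_lt => //; rewrite ltr_nat.
    by apply: (deg_clique_gt S_clique wS vS); rewrite adj_sym.
  have wv' : ~~ adj w v'.
    have [z zS v'z] := pend _ v'S.
    by rewrite adj_sym v'z /=; move: v'w'; rewrite v'z => /eqP <-.
  have : (deg w <= #|~: [set w; v']|)%N.
    apply/subset_leq_card/subsetP => z; rewrite !inE; apply: contraTN.
    by move=> /orP[] /eqP ->; rewrite ?adj_irrefl.
  have := cardsC [set w; v']; rewrite cards2.
  have -> : w != v' by apply: contraNneq v'S => <-.
  by lia.
(* Since [L] is affine, only the number a + 1 of clique vertices and their degree sum (a + 1) a + (b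
   - a) = a a + b matter. These are the same for a degrees equal to a and one equal to b. *)
have -> : b `^ gamma + a * a `^ gamma = \sum_(u in S) L (deg u)%:R.
  rewrite /L -mulr_suml big_split /= -!mulr_suml !sumrB !sumr_const.
  rewrite -natr_sum (sum_deg_clique S_clique pend) natrD natrM -/a.
  have -> : #|~: S|%:R = b - a by rewrite /b /a -natrB; [congr _%:R|]; lia.
  have sE : #|S|%:R = a + 1 :> R by rewrite natr1; congr _%:R; lia.
  rewrite -[b *+ _]mulr_natl -[a *+ _]mulr_natl sE.
  by field; rewrite subr_eq0 gt_eqF.
rewrite (bigD1 w)//= [ltRHS](bigD1 w)//=; apply: ltr_leD => //.
by apply: ler_sum => u /andP[uS _]; exact: chord.
Qed.

End Randic.

(** * Case analysis and conclusion *)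

(** This dichotomy yields both the bound and its equality case, since the pineapple attains the
    bound. *)
Lemma randic_lt_or_pineapple (R : realType) (gamma : R) (G : sgraph) :
  gamma <= -1 -> connected G ->
  (1 < chromatic_number G < #|G|)%N ->
  general_randic0 gamma G < pineapple_bound gamma #|G| (chromatic_number G) \/
  graph_iso G (pineapple #|G| (chromatic_number G)).
Proof.
move=> gamma_le G_conn; set c := chromatic_number G => /andP[c1 cn].
have G1 : (1 < #|G|)%N by lia.
have deg_pos := deg_gt0 G_conn G1.
(* The colouring lemmas are applied with c - 1 colours, one fewer than the chromatic number. *)
have k0 : (0 < c.-1)%N by lia.
have kc : (c.-1 < c)%N by lia.
pose B := [set v : G | (c.-1 <= deg v)%N].
have Bc : (c <= #|B|)%N by have := card_large_degree k0 kc; rewrite -/B; lia.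
have [/andP[c2 cB]|] := boolP ((2 < c) && (c < #|B|))%N.
  left; apply: (randic_lt_many gamma_le deg_pos c2 cB) => u.
  by rewrite inE.
rewrite negb_and -!leqNgt => cB.
have [S Sc S_clique] : exists2 S : {set G}, #|S| = c &
    {in S &, forall u v, u != v -> adj u v}.
  case/orP: cB => cB; last first.
    exists B; first by lia.
    by apply: large_degree_clique => //; rewrite -/B; lia.
  have c2 : c = 2 by lia.
  have /card_gt0P[u _] : (0 < #|G|)%N by lia.
  have [v uv] := connected_neighbour G_conn G1 u.
  exists [set u; v].
    rewrite cards2 c2; suff -> : u != v by [].
    by apply: contraTneq uv => ->; rewrite adj_irrefl.
  move=> x y; rewrite !inE => /orP[] /eqP-> /orP[] /eqP->; rewrite ?eqxx//.
  by rewrite adj_sym.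
have S1 : (1 < #|S|)%N by lia.
rewrite -Sc.
have Sn0 : S != set0 by rewrite -card_gt0; lia.
have /card_gt0P[v0] : (0 < #|~: S|)%N by have := cardsC S; lia.
rewrite inE => v0S; have /set0Pn[x0 x0S] := Sn0.
have [x [y [xS yS xy]]] := connected_cut G_conn x0S v0S.
have [/forallP deg1|] := boolP [forall v, (v \notin S) ==> (deg v == 1)%N]; last first.
  rewrite negb_forall => /existsP[v]; rewrite negb_imply => /andP[vS dv].
  left; apply: (randic_lt_not_pendant gamma_le deg_pos S_clique S1 xS yS xy vS).
  by have := deg_pos v; lia.
have pend v : v \notin S -> exists2 w, w \in S & adj v =1 pred1 w.
  move=> vS; apply: (pendant_neighbour G_conn Sn0) => // u uS.
  by have /implyP/(_ uS)/eqP := deg1 u.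
have [w wS v0w] := pend _ v0S.
(* The neighbour [w] of one outside vertex is the only candidate for a common centre. *)
have [/forallP allw|] := boolP [forall v, (v \notin S) ==> adj v w].
  right; apply: (pineapple_iso S_clique wS) => v vS.
  have [w' w'S vw'] := pend _ vS.
  have /implyP/(_ vS) := allw v.
  by rewrite vw' => /eqP ->.
rewrite negb_forall => /existsP[v]; rewrite negb_imply => /andP[vS vw].
have [w' w'S vw'] := pend _ vS.
left; apply: (randic_lt_two_centres gamma_le deg_pos S_clique S1 wS w'S _ v0S vS) => //.
- by move: vw; rewrite vw'.
- by rewrite v0w /= eqxx.
- by rewrite vw' /= eqxx.
Qed.

Unset Implicit Arguments.
Set Strict Implicit.

Theorem theorem3p3 (R : realType) (n c : nat) (gamma : R)
    (c_gt1 : (1 < c)%N) (c_ltn : (c < n)%N) (gamma_le : gamma <= -1)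
    (G : sgraph) (G_conn : connected G) (G_order : #|G| = n)
    (G_chi : chromatic_number G = c) :
  let bound : R := n%:R - c%:R + (n%:R - 1) `^ gamma
                   + (c%:R - 1) * (c%:R - 1) `^ gamma in
  general_randic0 gamma G <= bound /\
  (general_randic0 gamma G = bound <-> graph_iso G (pineapple n c)).
Proof.
move=> bound.
have -> : bound = pineapple_bound gamma n c.
  rewrite /bound /pineapple_bound -!subn1 !natrB//; lia.
have eq_iso : graph_iso G (pineapple n c) ->
    general_randic0 gamma G = pineapple_bound gamma n c.
  by move/general_randic0_iso ->; exact: general_randic0_pineapple.
have := randic_lt_or_pineapple gamma_le G_conn.
rewrite G_order G_chi c_gt1 c_ltn => /(_ isT)[lt_bound|iso].
  split; first exact: ltW.
  by split=> [eq_bound|/eq_iso//]; rewrite eq_bound ltxx in lt_bound.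
by rewrite eq_iso.
Qed.
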